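(* Let $(X,\rho)$ be a Hadamard space, let $K\subset X$ be nonempty, closed and convex, and let $F:K\times K\to\mathbb{R}$ be a monotone bifunction with $\operatorname{dom}(J_F)\neq\varnothing$, where $J_F : X\rightrightarrows K$ is the resolvent of $F$. Then the following hold. (i) $J_F$ is single-valued (i.e. $J_F(x)$ is a singleton for every $x\in\operatorname{dom}(J_F)$). (ii) If $\operatorname{dom}(J_F)\supset K$, then $J_F$ restricted to $K$ is nonexpansive, i.e. $\rho(J_F(x),J_F(y))\le\rho(x,y)$ for all $x,y\in K$. (iii) If $\operatorname{dom}(J_{\mu F})\supset K$ for every $\mu>0$, then $\operatorname{Fix}(J_F)=\mathcal{E}(K,F)$.
   Context: A Hadamard space is a complete CAT(0) space. For $u,v,x,y\in X$ write $\overrightarrow{uv}:=(u,v)$ and define the quasilinearization $$\langle\overrightarrow{uv},\overrightarrow{xy}\rangle := \tfrac12\left[\rho^2(u,y)+\rho^2(v,x)-\rho^2(u,x)-\rho^2(v,y)\right].$$ $F$ is monotone if $F(x,y)+F(y,x)\le 0$ for all $x,y\in K$. The resolvent of $F$ is the set-valued map $J_F:X\rightrightarrows K$, $$J_F(x):=\{z\in K : F(z,y)-\langle\overrightarrow{zx},\overrightarrow{zy}\rangle\ge 0\ \ \forall y\in K\},$$ and $\operatorname{dom}(J_F):=\{x\in X: J_F(x)\neq\varnothing\}$; $J_{\mu F}$ is the resolvent of the bifunction $\mu F$. $\operatorname{Fix}(J_F)$ is the set of $x\in K$ with $x=J_F(x)$, and $\mathcal{E}(K,F):=\{\bar x\in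 K: F(\bar x,y)\ge 0\ \forall y\in K\}$. *)

(* Defs.v *)
From HB Require Import structures.
From mathcomp Require Import all_boot all_order all_algebra.
From mathcomp Require Import all_classical all_reals all_analysis.

Set Implicit Arguments.
Unset Strict Implicit.
Unset Printing Implicit Defensive.

Import Order.TTheory GRing.Theory Num.Theory.

Local Open Scope classical_set_scope.
Local Open Scope ring_scope.

Section Hadamard.
Context {R : realType}.

(* The library norm on [R * R] is the sup norm, hence this explicit distance. *)
Definition eucl_dist (p q : R * R) : R :=
  Num.sqrt ((p.1 - q.1) ^+ 2 + (p.2 - q.2) ^+ 2).

Definition eucl_segment (p q : R * R) : set (R * R) :=
  [set (1 - t) *: p + t *: q | t in `[0, 1]].

Context {X : metricType R}.

(* Geodesic paths are parametrized by arc length on [0, mdist x y]; the values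
   of [c] outside of this interval are irrelevant. *)
Definition geodesic_path (x y : X) (c : R -> X) : Prop :=
  [/\ c 0 = x, c (mdist x y) = y &
      forall s t : R, s \in `[0, mdist x y] -> t \in `[0, mdist x y] ->
        mdist (c s) (c t) = `|s - t|].

Definition geodesic_segment (x y : X) (S : set X) : Prop :=
  exists2 c : R -> X, geodesic_path x y c & S = c @` `[0, mdist x y].

Definition geodesic_space : Prop :=
  forall x y : X, exists S : set X, geodesic_segment x y S.

(* Vertices and sides are indexed cyclically: side [i] joins the vertices [i]
   and [ordS i = i + 1 mod 3]. *)
Definition geodesic_triangle (v : 'I_3 -> X) (S : 'I_3 -> set X) : Prop :=
  forall i, geodesic_segment (v i) (v (ordS i)) (S i).

Definition comparison_triangle (v : 'I_3 -> X) (w : 'I_3 -> R * R) : Prop :=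
  forall i, eucl_dist (w i) (w (ordS i)) = mdist (v i) (v (ordS i)).

(* [x'] is the comparison point of a point [x] lying on side [i]. *)
Definition comparison_point (v : 'I_3 -> X) (w : 'I_3 -> R * R) (i : 'I_3)
    (x : X) (x' : R * R) : Prop :=
  eucl_segment (w i) (w (ordS i)) x' /\ eucl_dist (w i) x' = mdist (v i) x.

Definition cat0_inequality : Prop :=
  forall (v : 'I_3 -> X) (S : 'I_3 -> set X) (w : 'I_3 -> R * R),
    geodesic_triangle v S -> comparison_triangle v w ->
    forall (i j : 'I_3) (x y : X) (x' y' : R * R), S i x -> S j y ->
      comparison_point v w i x x' -> comparison_point v w j y y' ->
      mdist x y <= eucl_dist x' y'.

Definition geodesically_convex (K : set X) : Prop :=
  forall (x y : X) (S : set X), K x -> K y -> geodesic_segment x y S ->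
    S `<=` K.

Definition quasilin (u v x y : X) : R :=
  2^-1 * (mdist u y ^+ 2 + mdist v x ^+ 2 - mdist u x ^+ 2 - mdist v y ^+ 2).

End Hadamard.

Definition complete_space (T : uniformType) : Prop :=
  forall F : set_system T, ProperFilter F -> cauchy F ->
    exists l : T, F --> l.

Definition hadamard_space (R : realType) (X : metricType R) : Prop :=
  [/\ complete_space X, @geodesic_space R X & @cat0_inequality R X].

(* A subset [K] of [X] used as a type is the subtype of its elements, with
   [val : K -> X]; bifunctions are thus defined on [K] x [K] only. *)
Section Resolvent.
Context {R : realType} {X : metricType R} {K : set X}.

Definition monotone_bifun (F : K -> K -> R) : Prop :=
  forall x y : K, F x y + F y x <= 0.

Definition resolvent (F : K -> K -> R) (x : X) : set K :=
  [set z : K | forall y : K, 0 <= F z y - quasilin (val z) x (val z) (val y)].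

Definition dom (J : X -> set K) : set X := [set x | J x !=set0].

Definition single_valued (J : X -> set K) : Prop :=
  forall x : X, dom J x -> exists z : K, J x = [set z].

(* [J] restricted to [K] is (the graph of) a nonexpansive map. *)
Definition nonexpansive_restr (J : X -> set K) : Prop :=
  exists T : K -> K, (forall x : K, J (val x) = [set T x]) /\
    forall x y : K, mdist (val (T x)) (val (T y)) <= mdist (val x) (val y).

Definition Fix (J : X -> set K) : set K := [set x : K | J (val x) = [set x]].

Definition equilibria (F : K -> K -> R) : set K :=
  [set x : K | forall y : K, 0 <= F x y].

End Resolvent.

(* Main.v *)
(** The resolvent inequalities at [z1] and [z2] add up, by monotonicity, to a
    bound on [mdist z1 z2 ^+ 2]. For a common base point this gives uniqueness.
    For base points [x] and [y] it reads
    [2 d(z1,z2)^2 <= d(x,z2)^2 + d(y,z1)^2 - d(x,z1)^2 - d(y,z2)^2], whose right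
    side is at most [d(x,y)^2 + d(z1,z2)^2] by the quadrilateral inequality of
    CAT(0) spaces, a consequence of the Bruhat-Tits inequality at the midpoint
    of a diagonal. Finally, [quasilin x x x y = 0], so that [x] belongs to its
    own resolvent exactly when it is an equilibrium. *)
Require Import Defs.
From mathcomp Require Import all_boot all_order all_algebra.
From mathcomp Require Import all_classical all_reals all_analysis.
From mathcomp Require Import ring lra.

Import Order.TTheory GRing.Theory Num.Theory.

Local Open Scope classical_set_scope.
Local Open Scope ring_scope.

Lemma eucl_dist_sqr (R : realType) (p q : R * R) :
  eucl_dist p q ^+ 2 = (p.1 - q.1) ^+ 2 + (p.2 - q.2) ^+ 2.
Proof. by rewrite sqr_sqrtr // addr_ge0 ?sqr_ge0. Qed.

Lemma eucl_dist_eq (R : realType) (p q : R * R) (d : R) : 0 <= d ->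
  (p.1 - q.1) ^+ 2 + (p.2 - q.2) ^+ 2 = d ^+ 2 -> eucl_dist p q = d.
Proof. by move=> d0 e; rewrite /eucl_dist e sqrtr_sqr ger0_norm. Qed.

(** With one side on the first axis, the law of cosines forces the abscissa [p] of the apex; the
    triangle inequalities make the squared height [c ^+ 2 - p ^+ 2] nonnegative. *)
Lemma eucl_triangle_exists (R : realType) (a b c : R) :
  0 < a -> 0 <= b -> 0 <= c -> a <= b + c -> b <= c + a -> c <= a + b ->
  exists w : R * R, eucl_dist (a, 0) w = b /\ eucl_dist w (0, 0) = c.
Proof.
move=> a0 b0 c0 abc bca cab.
pose p := (c ^+ 2 + a ^+ 2 - b ^+ 2) / (2 * a).
have pE : 2 * a * p = c ^+ 2 + a ^+ 2 - b ^+ 2.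
  by rewrite /p; field; rewrite gt_eqF.
have q0 : 0 <= c ^+ 2 - p ^+ 2.
  have a4 : 0 < 4 * a ^+ 2 by rewrite mulr_gt0 ?exprn_gt0.
  rewrite -(pmulr_rge0 _ a4).
  (* Heron's formula: both sides are 16 times the squared area. *)
  have -> : 4 * a ^+ 2 * (c ^+ 2 - p ^+ 2) =
      (a + b + c) * (c + a - b) * ((b + c - a) * (a + b - c)).
    by transitivity ((2 * a * c) ^+ 2 - (2 * a * p) ^+ 2);
       [ring | rewrite pE; ring].
  by rewrite !mulr_ge0 //; lra.
exists (p, Num.sqrt (c ^+ 2 - p ^+ 2)).
split; apply: eucl_dist_eq => //=.
  by rewrite sub0r sqrrN sqr_sqrtr //; move: pE; nra.
by rewrite !subr0 sqr_sqrtr //; ring.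
Qed.

Section CAT0.
Context {R : realType} {X : metricType R}.
Hypotheses (X_geodesic : @geodesic_space R X) (X_cat0 : @cat0_inequality R X).

(* The Bruhat-Tits (CN) inequality. *)
Lemma cat0_midpoint (x y : X) : exists m : X, forall z : X,
  mdist z m ^+ 2 <=
    2^-1 * mdist z x ^+ 2 + 2^-1 * mdist z y ^+ 2 - 4^-1 * mdist x y ^+ 2.
Proof.
have [S0 hS0] := X_geodesic x y.
(* The planar construction divides by the base length, so [x = y] is treated apart, with [m = x]. *)
have [xy0|xy0] := eqVneq (mdist x y) 0.
  exists x => z; rewrite -(mdist_positivity _ _ xy0).
  by rewrite mdistxx; lra.
have a0 : 0 < mdist x y by rewrite lt_def xy0 mdist_ge0.
have [g [g0 g1 gE] S0E] := hS0.
have hmid : 2^-1 * mdist x y \in `[0, mdist x y] by rewrite in_itv /=; lra.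
exists (g (2^-1 * mdist x y)) => z.
have [||||||w [yw wx]] :=
  eucl_triangle_exists R (mdist x y) (mdist y z) (mdist z x).
- by [].
- exact: mdist_ge0.
- exact: mdist_ge0.
- by have := metric_triangle x z y; rewrite (metric_sym x z) (metric_sym z y); lra.
- by have := metric_triangle y x z; rewrite (metric_sym y x) (metric_sym x z); lra.
- by have := metric_triangle z y x; rewrite (metric_sym y x) (metric_sym z y); lra.
have [S1 hS1] := X_geodesic y z.
have [S2 hS2] := X_geodesic z x.
(* Side 0 joins [x] to [y] and carries the midpoint; side 2 wraps around from [z] to [x], so that
   [z] is its initial point. *)
pose v (i : 'I_3) := nth x [:: x; y; z] i.
pose S (i : 'I_3) := nth set0 [:: S0; S1; S2] i.
pose u (i : 'I_3) := nth (0, 0) [:: (0, 0); (mdist x y, 0); w] i.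
have tri : geodesic_triangle v S by case=> [[|[|[|//]]] i3].
have cmp : comparison_triangle v u.
  case=> [[|[|[|//]]] i3] //; rewrite /u /v /=.
  by apply: eucl_dist_eq => /=; [exact: mdist_ge0 | ring].
have S0m : S0 (g (2^-1 * mdist x y)) by rewrite S0E; exists (2^-1 * mdist x y).
have S2z : S2 z.
  have [h [h0 _ _] ->] := hS2; exists 0 => //.
  by rewrite /= in_itv /= lexx mdist_ge0.
have cm : comparison_point v u ord0 (g (2^-1 * mdist x y)) (2^-1 * mdist x y, 0).
  split; rewrite /u /v /=.
    exists 2^-1; first by rewrite /= in_itv /=; lra.
    by congr pair => /=; rewrite /GRing.scale /=; ring.
  have := gE 0 (2^-1 * mdist x y); rewrite g0 in_itv /= lexx mdist_ge0 => -> //.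
  have half0 : 0 <= 2^-1 * mdist x y by lra.
  rewrite sub0r normrN ger0_norm //.
  by apply: eucl_dist_eq => //=; ring.
have cz : comparison_point v u ord_max z w.
  split; rewrite /u /v /=.
    exists 0; first by rewrite /= in_itv /= lexx ler01.
    by rewrite subr0 scale1r scale0r addr0.
  by rewrite mdistxx; apply: eucl_dist_eq => //; rewrite !subrr; ring.
have := X_cat0 _ _ _ tri cmp _ _ _ _ _ _ (S2z : S ord_max z) (S0m : S ord0 _) cz cm.
rewrite -(ler_pXn2r (n := 2)) ?nnegrE ?mdist_ge0 ?sqrtr_ge0 //.
rewrite eucl_dist_sqr (metric_sym z y) -yw -wx !eucl_dist_sqr /=.
(* In the plane the bound is an equality, the median length formula. *)
by move=> /le_trans; apply; rewrite le_eqVlt; apply/orP; left; apply/eqP; field.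
Qed.

Lemma cat0_quadrilateral (x y b c : X) :
  mdist x c ^+ 2 + mdist y b ^+ 2 <=
    mdist x b ^+ 2 + mdist y c ^+ 2 + mdist x y ^+ 2 + mdist b c ^+ 2.
Proof.
have [m hm] := cat0_midpoint x c.
have := hm b; have := hm y.
(* Together with [(s + t)^2 <= 2 s^2 + 2 t^2], this reduces the claim to the midpoint inequality at
   [b] and at [y]. *)
have : mdist y b ^+ 2 <= (mdist y m + mdist b m) ^+ 2.
  rewrite ler_pXn2r ?nnegrE ?addr_ge0 ?mdist_ge0 //.
  by rewrite (metric_sym b m) metric_triangle.
have := sqr_ge0 (mdist y m - mdist b m).
by rewrite (metric_sym y x) (metric_sym b x) sqrrB sqrrD; lra.
Qed.

End CAT0.

Section Resolvent.
Context {R : realType} {X : metricType R} {K : set X} {F : K -> K -> R}.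

Lemma resolvent_dist (F_monotone : monotone_bifun F) {x y : X} {a b : K} :
  resolvent F x a -> resolvent F y b ->
  2 * mdist (val a) (val b) ^+ 2 <=
    mdist x (val b) ^+ 2 + mdist y (val a) ^+ 2
    - mdist x (val a) ^+ 2 - mdist y (val b) ^+ 2.
Proof.
move=> /(_ b) + /(_ a); have := F_monotone a b.
by rewrite /quasilin !mdistxx (metric_sym (val b) (val a)); lra.
Qed.

Lemma resolvent_uniq (F_monotone : monotone_bifun F) {x : X} {a : K} :
  resolvent F x a -> resolvent F x = [set a].
Proof.
move=> xa; apply/seteqP; split => [b xb|_ -> //].
apply/val_inj/mdist_positivity/eqP; rewrite -sqrf_eq0 eq_le sqr_ge0 andbT.
(* With equal base points the right-hand side cancels to 0. *)
by have := resolvent_dist F_monotone xb xa; lra.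
Qed.

Lemma resolvent_self (x : K) :
  resolvent F (val x) x <-> equilibria F x.
Proof.
by split=> Fx y; have := Fx y; rewrite /quasilin mdistxx; lra.
Qed.

End Resolvent.

Theorem proposition5p4 (R : realType) (X : metricType R)
    (hX : hadamard_space X) (K : set X) (K_nonempty : K !=set0)
    (K_closed : closed K) (K_convex : geodesically_convex K)
    (F : K -> K -> R) (F_monotone : monotone_bifun F)
    (domF : dom (resolvent F) !=set0) :
  [/\ single_valued (resolvent F),
      K `<=` dom (resolvent F) -> nonexpansive_restr (resolvent F) &
      (forall mu : R, 0 < mu ->
         K `<=` dom (resolvent (fun x y : K => mu * F x y))) ->
      Fix (resolvent F) = equilibria F].
Proof.
have [_ X_geodesic X_cat0] := hX.
split.
- by move=> x [z xz]; exists z; exact: resolvent_uniq.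
- move=> Kdom.
  have /choice[T TP] : forall x : K, exists z : K, resolvent F (val x) z.
    by move=> x; apply: Kdom; exact: set_valP.
  exists T; split=> [x|x y]; first exact: resolvent_uniq.
  rewrite -(ler_pXn2r (n := 2)) ?nnegrE ?mdist_ge0 //.
  (* Chaining the two bounds, one of the two copies of [d(T x, T y)^2] is absorbed, which leaves
     [d(T x, T y)^2 <= d(x, y)^2]. *)
  have := resolvent_dist F_monotone (TP x) (TP y).
  have := cat0_quadrilateral X_geodesic X_cat0
    (val x) (val y) (val (T x)) (val (T y)).
  lra.
- move=> _; apply/seteqP; split=> x.
    by rewrite /Fix /= => xx; apply/resolvent_self; rewrite xx.
  (* [Fix] asks for the resolvent to be exactly the singleton; uniqueness upgrades mere
     membership. *)
  by move=> /resolvent_self; exact: resolvent_uniq.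
Qed.
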